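(* Let $a,b\in\mathbb{R}$ with $b>a>0$. Let $f:[a,b]\to\mathbb{R}$ be absolutely continuous and let $g:[a,b]\to\mathbb{R}$ be Lebesgue integrable on $[a,b]$. Let $\ell(t)=t$ for $t\in[a,b]$. (1) If $f'\in L^\infty[a,b]$, then $$\left|\widehat{\mathcal{P}}(f,g)\right|\le\frac12\left\|f-\ell f'\right\|_\infty\int_a^b\int_a^b|x-t|\,\left|t g(x)-x g(t)\right|\,dt\,dx.$$ (2) If $f'\in L^p[a,b]$ with $p>1$ and $\frac1p+\frac1q=1$, then $$\left|\widehat{\mathcal{P}}(f,g)\right|\le\frac12\left(\frac{1}{2q-1}\right)^{1/q}\left\|f-\ell f'\right\|_p\int_a^b\int_a^b\left|\frac{x^q}{t^{q-1}}-\frac{t^q}{x^{q-1}}\right|^{1/q}\left|t g(x)-x g(t)\right|\,dt\,dx.$$ (3) If $f'\in L^1[a,b]$, then $$\left|\widehat{\mathcal{P}}(f,g)\right|\le\frac12\left\|f-\ell f'\right\|_1\int_a^b\int_a^b\frac{\max\{x,t\}}{\min\{x,t\}}\left|t g(x)-x g(t)\right|\,dt\,dx.$$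
   Context: For $b>a>0$ and real functions $f,g$ on $[a,b]$, the (Pompeiu–Chebyshev) functional is $$\widehat{\mathcal{P}}(f,g)=\frac{b^3-a^3}{3}\int_a^b f(x)g(x)\,dx-\left(\int_a^b x f(x)\,dx\right)\left(\int_a^b x g(x)\,dx\right).$$ $\|\cdot\|_p$ $(1\le p\le\infty)$ is the usual Lebesgue norm on $[a,b]$. *)

(* Defs.v *)
From HB Require Import structures.
From mathcomp Require Import all_boot all_order all_algebra.
From mathcomp Require Import all_classical all_reals all_analysis.

Set Implicit Arguments.
Unset Strict Implicit.
Unset Printing Implicit Defensive.

Import Order.TTheory GRing.Theory Num.Theory.
Import numFieldNormedType.Exports.

Local Open Scope classical_set_scope.
Local Open Scope ring_scope.

(* A function on [a, b] is represented by a total function R -> R whose values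
   outside [a, b] are irrelevant: the integrals and norms below are restricted
   to [a, b], and a derivative on [a, b] is changed at most at the two
   endpoints by modifying the function outside [a, b].
   The measure is the completed Lebesgue measure, so that measurability is
   Lebesgue, and not only Borel, measurability. *)

Definition absolutely_continuous (R : realType) (a b : R) (f : R -> R) : Prop :=
  forall e : R, 0 < e -> exists2 d : R, 0 < d &
    forall (n : nat) (u v : 'I_n -> R),
      (forall i, [/\ a <= u i, u i < v i & v i <= b]) ->
      trivIset setT (fun i => `]u i, v i[%classic) ->
      \sum_(i < n) (v i - u i) < d ->
      \sum_(i < n) `|f (v i) - f (u i)| < e.

Definition Lebesgue_integrable (R : realType) (a b : R) (g : R -> R) : Prop :=
  (@completed_lebesgue_measure R).-integrable `[a, b] (EFin \o g).

Definition in_Lp (R : realType) (a b : R) (p : \bar R) (h : R -> R) : Prop :=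
  (h \_ `[a, b]) \in Lfun (@completed_lebesgue_measure R) p.

Definition Lp_norm (R : realType) (a b : R) (p : \bar R) (h : R -> R) : \bar R :=
  'N[@completed_lebesgue_measure R]_p [EFin \o (h \_ `[a, b])].

Definition pompeiu_chebyshev (R : realType) (a b : R) (f g : R -> R) : R :=
  let mu := @completed_lebesgue_measure R in
  (b ^+ 3 - a ^+ 3) / 3 * (\int[mu]_(x in `[a, b]) (f x * g x)) -
  (\int[mu]_(x in `[a, b]) (x * f x)) * (\int[mu]_(x in `[a, b]) (x * g x)).

Definition double_integral (R : realType) (a b : R) (k : R -> R -> R) : \bar R :=
  let mu := @completed_lebesgue_measure R in
  (\int[mu]_(x in `[a, b]) \int[mu]_(t in `[a, b]) (k x t)%:E)%E.

(* Main.v *)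
Require Import Defs.
From HB Require Import structures.
From mathcomp Require Import all_boot all_order all_algebra.
From mathcomp Require Import all_classical all_reals all_analysis.
From mathcomp Require Import measurable_realfun ess_sup_inf.
From mathcomp Require Import ring lra.

(** The whole statement rests on one pointwise estimate and one identity.

    For f absolutely continuous on [a, b] with 0 < a, the quotient F t = f t / t
    is again absolutely continuous and F' = - (f - l f') / l^2 almost everywhere,
    so for x < t the fundamental theorem of calculus gives Pompeiu's formula

      t f x - x f t = x t int_x^t (f s - s f' s) / s^2 ds.

    Hoelder's inequality applied to the product of f - l f' with the weight
    s |-> s^-2 on ]x, t] bounds the right-hand side by the L^p norm of f - l f'
    times x t ||s^-2||_q, and this factor is the kernel of the corresponding case,
    up to the constant (2 q - 1)^(-1/q) for 1 < p < oo (increment_le_Linfty,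
    increment_le_Lp, increment_le_L1).

    On the other side, Korkine's identity (korkine)

      2 P(f, g) = int int (t f x - x f t) (t g x - x g t) dt dx

    comes from expanding the product and integrating term by term, first in t
    and then in x. The integrals are iterated throughout, so that linearity is
    enough and no theorem on product measures is involved. Bounding the first
    factor by the pointwise estimate gives the three inequalities (korkine_le).

    The fundamental theorem for absolutely continuous functions
    (absolutely_continuous_FTC) is where the work lies. The function F and its
    total variation V are both absolutely continuous, and F = V - (V - F) is a
    difference of nondecreasing absolutely continuous functions. The
    Lebesgue-Stieltjes measure of such a function is dominated by Lebesgue
    measure: a null set lies in an open set of small measure, which is a
    disjoint union of intervals on which the function increases little in
    total. The Radon-Nikodym density psi of this measure satisfies
    F x - F a = int_a^x psi, and Lebesgue's differentiation theorem gives
    F' = psi almost everywhere.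

    The Borel functions obtained this way are compared with Lebesgue measurable
    ones through the fact that the completed measure restricts to Lebesgue
    measure on Borel sets (ge0_integral_completed). *)

Import Order.TTheory GRing.Theory Num.Theory.
Import numFieldNormedType.Exports.

Set Implicit Arguments.
Unset Strict Implicit.
Unset Printing Implicit Defensive.

Local Open Scope classical_set_scope.
Local Open Scope ring_scope.

(** * Absolute continuity and total variation *)

Section absolute_continuity_families.
Context {R : realType}.
Implicit Types (a b : R) (f : R -> R).

(** Families indexed by any finite type, with degenerate intervals allowed, are
    what refining or clipping a family of intervals produces; the degenerate
    members are discarded before the definition is applied. *)
Lemma absolutely_continuous_family a b f : absolutely_continuous a b f ->
  forall e : R, 0 < e -> exists2 d : R, 0 < d &
    forall (I : finType) (u v : I -> R),
      (forall i, [/\ a <= u i, u i <= v i & v i <= b]) ->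
      trivIset setT (fun i => `]u i, v i[%classic) ->
      \sum_i (v i - u i) < d -> \sum_i `|f (v i) - f (u i)| < e.
Proof.
move=> fAC e /fAC[d d0 fd]; exists d => // I u v uv tuv uvd.
pose A := [pred i | u i < v i].
have sumA (F : I -> R) : (forall i, u i = v i -> F i = 0) ->
    \sum_i F i = \sum_(j < #|A|) F (enum_val j).
  move=> F0; rewrite -(big_enum_val (A := A) F) [RHS]big_mkcond/=.
  apply: eq_bigr => i _; rewrite inE/=; case: ltP => // vu.
  by rewrite F0//; apply/eqP; rewrite eq_le vu andbT; case: (uv i).
rewrite sumA => [|i ->]; last by rewrite subrr normr0.
apply: (fd _ (u \o enum_val) (v \o enum_val)) => [i| |] /=.
- by have [? _ ?] := uv (enum_val i); split => //; exact: (enum_valP i).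
- by move=> i j _ _ ij; apply/enum_val_inj; exact: tuv ij.
- by rewrite -(sumA (fun i => v i - u i))// => i ->; rewrite subrr.
Qed.

Lemma absolutely_continuous_dist a b f : absolutely_continuous a b f ->
  forall e : R, 0 < e -> exists2 d : R, 0 < d &
    forall x y, a <= x -> x <= y -> y <= b -> y - x < d -> `|f y - f x| < e.
Proof.
move=> /absolutely_continuous_family fAC e /fAC[d d0 fd].
exists d => // x y ax xy yb xyd.
have := fd unit (fun=> x) (fun=> y) (fun=> And3 ax xy yb).
rewrite !big_const card_unit /= !addr0; apply => //.
by move=> [] [].
Qed.

Lemma itv_partition_sum a b s : itv_partition a b s ->
  \sum_(i < size s) (nth b (a :: s) i.+1 - nth b (a :: s) i) = b - a.
Proof.
move=> abs; rewrite -(big_mkord xpredT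
  (fun i => nth b (a :: s) i.+1 - nth b (a :: s) i)) telescope_sumr//.
by rewrite (itv_partition_nth_size _ abs).
Qed.

Lemma itv_partition_nth_homo a b s i j : itv_partition a b s ->
  (i <= j)%N -> (j <= size s)%N -> nth b (a :: s) i <= nth b (a :: s) j.
Proof.
move=> [sas _] ij js; have : sorted <=%R (a :: s).
  by apply: sub_path sas => x y /ltW.
move=> ssorted; apply: (sorted_leq_nth le_trans lexx b ssorted) => //.
  by rewrite inE/= ltnS (leq_trans ij).
Qed.

Lemma itv_partition_trivIset a b s : itv_partition a b s ->
  trivIset setT (fun i : 'I_(size s) =>
    `]nth b (a :: s) i, nth b (a :: s) i.+1[%classic).
Proof.
move=> abs; suff H (i j : 'I_(size s)) : (i < j)%N ->
    `]nth b (a :: s) i, nth b (a :: s) i.+1[%classic `&`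
    `]nth b (a :: s) j, nth b (a :: s) j.+1[%classic !=set0 -> False.
  move=> i j _ _ ij; case: (ltngtP i j) => [/H/(_ ij)//|/H|/val_inj//].
  by move: ij; rewrite setIC => ij /(_ ij).
move=> ij [x [/=]]; rewrite !in_itv/= => /andP[_ xi] /andP[jx _].
have := itv_partition_nth_homo abs ij (ltnW (ltn_ord j)).
by rewrite leNgt (lt_trans jx xi).
Qed.

(** Subdividing each interval of a disjoint family yields again a disjoint
    family, with the same total length: absolute continuity therefore controls
    the sum of the variations, for partitions as fine as desired. *)
Lemma absolutely_continuous_sum_variation a b f :
  absolutely_continuous a b f ->
  forall e : R, 0 < e -> exists2 d : R, 0 < d &
    forall n (u v : 'I_n -> R) (s : 'I_n -> seq R),
      (forall i, [/\ a <= u i, u i <= v i & v i <= b]) ->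
      trivIset setT (fun i => `]u i, v i[%classic) ->
      (forall i, itv_partition (u i) (v i) (s i)) ->
      \sum_i (v i - u i) < d -> \sum_i variation (u i) (v i) f (s i) < e.
Proof.
move=> /absolutely_continuous_family fAC e /fAC[d d0 fd].
exists d => // n u v s uv tuv suv uvd.
pose x i k := nth (v i) (u i :: s i) k.
under eq_bigr do rewrite /variation big_mkord.
rewrite (sig_big_dep (fun=> true) (fun _ _ => true)
  (fun i (k : 'I_(size (s i))) => `|f (x i k.+1) - f (x i k)|)) /=.
(* the subintervals are indexed by pairs of an interval and a position in its
   partition *)
apply: (fd {i : 'I_n & 'I_(size (s i))} (fun p => x (tag p) (tagged p))
             (fun p => x (tag p) (tagged p).+1)) => [[i k]|[i k] [j l] _ _|] /=.
- have [aui uvi vib] := uv i; split.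
  + by rewrite (le_trans aui)// itv_partition_nth_ge// ltnS ltnW.
  + exact: itv_partition_nth_homo.
  + by rewrite (le_trans _ vib)// itv_partition_nth_le// ltnS.
- have sub m (q : 'I_(size (s m))) :
      `]x m q, x m q.+1[%classic `<=` `]u m, v m[%classic.
    move=> y /=; rewrite !in_itv/= => /andP[xy yx]; apply/andP; split.
      by rewrite (le_lt_trans _ xy)// itv_partition_nth_ge// ltnS ltnW.
    by rewrite (lt_le_trans yx)// itv_partition_nth_le// ltnS.
  move=> kl; have ij : i = j.
    by apply: (tuv i j) => //; case: kl => y [/sub iy /sub jy]; exists y.
  subst j; congr Tagged.
  exact: (itv_partition_trivIset (suv i)) kl.
- rewrite -(sig_big_dep (fun=> true) (fun _ _ => true)
    (fun i (k : 'I_(size (s i))) => x i k.+1 - x i k)) /=.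
  by under eq_bigr do rewrite itv_partition_sum//.
Qed.

(** The variation is at most 1 on any interval shorter than the d associated with
    e = 1, and finitely many steps of length d / 2 cover [a, b]. *)
Lemma absolutely_continuous_bounded_variation a b f : a <= b ->
  absolutely_continuous a b f -> bounded_variation a b f.
Proof.
move=> ab fAC; have [d d0 fd] := absolutely_continuous_sum_variation fAC ltr01.
have short x y : a <= x -> x <= y -> y <= b -> y - x < d ->
    total_variation x y f \is a fin_num.
  move=> ax xy yb xyd; apply/bounded_variationP => //; exists 1 => _ [s xys <-].
  have := fd 1 (fun=> x) (fun=> y) (fun=> s) (fun=> And3 ax xy yb).
  by rewrite !big_ord1 => h; apply/ltW/h => // i j _ _ _; rewrite !ord1.
have [N bN] : exists N : nat, b - a < N%:R * (d / 2).
  exists (Num.truncn ((b - a) / (d / 2))).+1.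
  by rewrite -ltr_pdivrMr ?divr_gt0// truncnS_gt.
suff H k x : a <= x -> x <= b -> x - a < k%:R * (d / 2) ->
    total_variation a x f \is a fin_num.
  by apply/bounded_variationP => //; apply: H bN.
elim: k x => [x|k ih x] ax xb; first by rewrite mul0r subr_lt0 ltNge ax.
rewrite -natr1 mulrDl mul1r => xk.
have [xd|dx] := ltP (x - a) d; first exact: short.
rewrite (@total_variationD _ _ _ (x - d / 2)); [|lra|lra].
by rewrite fin_numD ih ?short//; lra.
Qed.

Lemma total_variation_fin_num a b f : absolutely_continuous a b f ->
  forall x y, a <= x -> x <= y -> y <= b -> total_variation x y f \is a fin_num.
Proof.
move=> fAC x y ax xy yb; apply/bounded_variationP => //.
have ay := le_trans ax xy.
apply: (bounded_variationr ax xy); apply: (bounded_variationl ay yb).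
by apply: absolutely_continuous_bounded_variation => //; exact: le_trans yb.
Qed.

Lemma fine_total_variationB a b f : absolutely_continuous a b f ->
  forall x y, a <= x -> x <= y -> y <= b ->
  fine (total_variation a y f) - fine (total_variation a x f) =
  fine (total_variation x y f).
Proof.
move=> fAC x y ax xy yb; have fin := total_variation_fin_num fAC.
rewrite (total_variationD f ax xy) fineD ?fin ?(le_trans xy)//.
by rewrite addrC addKr.
Qed.

(** On each interval of a disjoint family the total variation is nearly attained
    by a partition, so the sum of total variations is at most e / 2 plus the
    approximation errors. *)
Lemma absolutely_continuous_total_variation a b f : a <= b ->
  absolutely_continuous a b f ->
  absolutely_continuous a b (fun x => fine (total_variation a x f)).
Proof.
move=> ab fAC e e0.
have e2 : 0 < e / 2 by lra.
have [d d0 fd] := absolutely_continuous_sum_variation fAC e2.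
exists d => // n u v uv tuv uvd.
have fin := total_variation_fin_num fAC.
(* an error e / 2 / n.+1 on each of the n intervals: n may be 0 *)
have /boolp.choice[s sP] : forall i, exists si, itv_partition (u i) (v i) si
    /\ fine (total_variation (u i) (v i) f) - e / 2 / n.+1%:R
       < variation (u i) (v i) f si.
  move=> i; have [aui /ltW uvi vib] := uv i.
  have en0 : 0 < e / 2 / n.+1%:R by rewrite divr_gt0.
  have := ub_ereal_sup_adherent en0 (fin _ _ aui uvi vib).
  move=> [_ [_ [s us <-] <-]]; rewrite -/(total_variation _ _ _) => h.
  exists s; split => //; rewrite -lte_fin EFinB fineK//; exact: fin.
have svar := fd n u v s (fun i => let: And3 p q r := uv i in And3 p (ltW q) r) tuv
  (fun i => (sP i).1) uvd.
rewrite (eq_bigr (fun i => fine (total_variation (u i) (v i) f))); last first.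
  move=> i _; have [aui /ltW uvi vib] := uv i.
  rewrite (fine_total_variationB fAC)// ger0_norm// fine_ge0//.
  exact: total_variation_ge0.
apply: (@le_lt_trans _ _ (\sum_(i < n) (variation (u i) (v i) f (s i)
    + e / 2 / n.+1%:R))).
  by apply: ler_sum => i _; rewrite -lerBlDr ltW//; case: (sP i).
rewrite big_split/= sumr_const card_ord [ltRHS]splitr; apply: ltr_leD svar _.
rewrite -(mulr_natr (e / 2 / _) n) -(mulrA (e / 2)) ler_piMr ?(ltW e2)//.
rewrite mulrC ler_pdivrMr//.
by rewrite mul1r ler_nat.
Qed.

Lemma absolutely_continuousB a b f g : absolutely_continuous a b f ->
  absolutely_continuous a b g -> absolutely_continuous a b (fun x => f x - g x).
Proof.
move=> fAC gAC e e0; have e2 : 0 < e / 2 by lra.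
have [d d0 fd] := fAC _ e2; have [d' d'0 gd] := gAC _ e2.
exists (Num.min d d'); first by rewrite lt_min d0.
move=> n u v uv tuv; rewrite lt_min => /andP[/(fd _ _ _ uv tuv) hf].
move=> /(gd _ _ _ uv tuv) hg.
rewrite [e]splitr; apply: le_lt_trans (ltrD hf hg).
rewrite -big_split ler_sum// => i _ /=.
have -> : f (v i) - g (v i) - (f (u i) - g (u i)) =
  (f (v i) - f (u i)) - (g (v i) - g (u i)) by ring.
exact: ler_normB.
Qed.

Lemma absolutely_continuous_le_bound a b f : a <= b ->
  absolutely_continuous a b f ->
  exists2 M, 0 < M & forall x, a <= x -> x <= b -> `|f x| <= M.
Proof.
move=> ab /(absolutely_continuous_bounded_variation ab) BVf.
have TVfin := iffLR (bounded_variationP f ab) BVf.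
have TV0 := fine_ge0 (total_variation_ge0 f ab).
exists (`|f a| + fine (total_variation a b f) + 1) => [|x ax xb].
  by rewrite ltr_wpDl// addr_ge0.
have : `|f x - f a| <= fine (total_variation a b f).
  rewrite -lee_fin fineK// (total_variationD f ax xb).
  by rewrite (le_trans (total_variation_ge f ax))// leeDl// total_variation_ge0.
have := ler_normD (f x - f a) (f a); rewrite subrK => h1 h2.
by rewrite (le_trans h1)// addrC (le_trans (lerD (lexx _) h2))// lerDl.
Qed.

Lemma absolutely_continuous_div_id a b f : 0 < a -> a <= b ->
  absolutely_continuous a b f -> absolutely_continuous a b (fun x => f x / x).
Proof.
move=> a0 ab fAC e e0.
have [M M0 fM] := absolutely_continuous_le_bound ab fAC.
have e1 : 0 < e / 2 * a by rewrite mulr_gt0// divr_gt0.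
have [d d0 fd] := fAC _ e1.
exists (Num.min d (e / 2 * (a ^+ 2 / M))).
  by rewrite lt_min d0/= !mulr_gt0// ?invr_gt0// exprn_gt0.
move=> n u v uv tuv; rewrite lt_min => /andP[/(fd _ _ _ uv tuv) fuv uvd].
have step i : `|f (v i) / v i - f (u i) / u i| <=
    `|f (v i) - f (u i)| / a + M / a ^+ 2 * (v i - u i).
  have [aui uvi vib] := uv i.
  have u0 : 0 < u i by exact: lt_le_trans aui.
  have v0 : 0 < v i by exact: lt_trans uvi.
  have -> : f (v i) / v i - f (u i) / u i =
      (f (v i) - f (u i)) / v i - f (u i) / (u i * v i) * (v i - u i).
    by field; rewrite !gt_eqF.
  rewrite (le_trans (ler_normB _ _))// !normrM !normfV (gtr0_norm v0).
  rewrite normrM (gtr0_norm v0) (gtr0_norm u0) [`|v i - _|]gtr0_norm ?subr_gt0//.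
  apply: lerD; first by rewrite ler_wpM2l// lef_pV2 ?posrE// (le_trans aui)// ltW.
  rewrite ler_wpM2r ?subr_ge0 ?(ltW uvi)// ler_pM//.
  - by rewrite invr_ge0 mulr_ge0// ltW.
  - by apply: fM => //; rewrite (le_trans (ltW uvi)).
  - rewrite lef_pV2 ?posrE ?mulr_gt0 ?exprn_gt0//.
    by rewrite expr2 ler_pM ?(ltW a0)// (le_trans aui)// ltW.
apply: (le_lt_trans (ler_sum _ (fun i _ => step i))).
rewrite big_split/= -mulr_suml -mulr_sumr [ltRHS]splitr ltrD//.
  by rewrite ltr_pdivrMr.
rewrite mulrC -ltr_pdivlMr ?divr_gt0 ?exprn_gt0//.
by rewrite invf_div.
Qed.

End absolute_continuity_families.

(** * Domination of Lebesgue-Stieltjes measures *)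

Section nondecreasing_absolutely_continuous.
Context {R : realType}.

Lemma open_interval_finite_measure (I : set R) : open I -> is_interval I ->
  (lebesgue_measure I < +oo)%E -> exists u v : R, u <= v /\ I = `]u, v[%classic.
Proof.
move=> oI itvI; have [->|/set0P[z Iz]] := eqVneq I set0.
  by exists 0, 0; rewrite lexx set_itvoo0.
have IE : [set` Rhull I] = I by apply/RhullK; rewrite inE.
rewrite -IE in oI Iz *; move: (Rhull I) oI Iz => i oi iz; clear IE.
rewrite lebesgue_measure_itv.
case: i oi iz => -[s x|[]] [t y|[]] oi /=; rewrite ?in_itv//= ?andbF// => iz.
- move=> _; exists x, y; split; last first.
    by rewrite -(interior_itv_bnd x y s t) (interior_id _).1.
  by case: s t iz {oi} => -[] /andP[xz zy]; rewrite (le_trans (y := z))// ?ltW.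
- by rewrite ltry.
- by rewrite ltNyr.
Qed.

Lemma lebesgue_stieltjes_measure_itvoc (f : cumulative R R) (u v : R) :
  u <= v -> lebesgue_stieltjes_measure f `]u, v] = (f v - f u)%:E.
Proof.
move=> uv; rewrite /lebesgue_stieltjes_measure/= /measure_extension/=.
by rewrite measurable_mu_extE; [exact: wlength_itv_bnd|exact: is_ocitv].
Qed.

(** By outer regularity a null set has open neighbourhoods U of measure less than
    d. Such a U is a disjoint union of bounded open intervals, and every finite
    part of this union has Stieltjes measure less than e. *)
Lemma lebesgue_stieltjes_measure_dominates (f : cumulative R R) :
  (forall e : R, 0 < e -> exists2 d : R, 0 < d &
    forall n (u v : nat -> R), (forall i, u i <= v i) ->
      trivIset setT (fun i => `]u i, v i[%classic) ->
      \sum_(0 <= i < n) (v i - u i) < d ->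
      \sum_(0 <= i < n) (f (v i) - f (u i)) < e) ->
  lebesgue_stieltjes_measure f `<< lebesgue_measure.
Proof.
move=> fAC; apply/null_content_dominatesP => N mN N0.
apply/eqP; rewrite eq_le measure_ge0 andbT; apply/lee_addgt0Pr => e e0.
rewrite add0e; have [d d0 fd] := fAC e e0.
have [|U [oU NU UNd]] := lebesgue_regularity_outer mN _ d0.
  by rewrite N0 ltry.
have mU : measurable (U : set (measurableTypeR R)) by
  exact: open_measurable.
have Ud : (lebesgue_measure U < d%:E)%E.
  rewrite -(setDUK NU) (le_lt_trans (measureU2 _ _ _))//.
    exact: measurableD.
  by rewrite N0 add0e.
pose I := open_disjoint_itv oU.
have mI q : measurable (I q : set (measurableTypeR R)).
  by apply: open_measurable; exact: open_disjoint_itv_open.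
have UE : U = \bigcup_q I q := open_disjoint_itv_bigcup oU.
have tI : trivIset setT I := @open_disjoint_itv_trivIset _ _ oU.
have IU q : I q `<=` U by rewrite UE; exact: bigcup_sup.
have /boolp.choice[uv uvP] : forall q, exists uv : R * R,
    uv.1 <= uv.2 /\ I q = `]uv.1, uv.2[%classic.
  move=> q; have [] := @open_interval_finite_measure (I q).
  - exact: open_disjoint_itv_open.
  - exact: open_disjoint_itv_is_interval.
  - apply: (@le_lt_trans _ _ (lebesgue_measure U)); last first.
      by rewrite (lt_trans Ud)// ltry.
    by apply: le_measure; rewrite ?inE.
  - by move=> u [v [le_uv IE]]; exists (u, v).
have Euv : (fun i => `](uv i).1, (uv i).2[%classic) = I.
  by apply/funext => q; rewrite (uvP q).2.
apply: (@le_trans _ _ (lebesgue_stieltjes_measure f U)).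
  by apply: le_measure; rewrite ?inE.
rewrite [in leLHS]UE measure_bigcup//.
apply: lime_le; first by apply: is_cvg_nneseries => *; exact: measure_ge0.
apply: nearW => n.
under eq_bigl do rewrite in_setT.
apply: (@le_trans _ _ (\sum_(0 <= i < n) (f (uv i).2 - f (uv i).1)%:E)%E).
  apply: lee_sum => i _; rewrite (uvP i).2.
  rewrite -lebesgue_stieltjes_measure_itvoc; last by case: (uvP i).
  apply: le_measure; rewrite ?inE//; exact: subset_itv_oo_oc.
rewrite sumEFin lee_fin ltW//; apply: fd.
- by move=> i; case: (uvP i).
- by rewrite Euv.
- rewrite -lte_fin -sumEFin (le_lt_trans _ Ud)// [in leRHS]UE measure_bigcup//.
  under eq_eseriesl do rewrite in_setT.
  apply: le_trans (nneseries_lim_ge n _) => [|k _ _]; last exact: measure_ge0.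
  apply: lee_sum => i _; rewrite (uvP i).2.
  have /= -> := @lebesgue_measure_itv R `](uv i).1, (uv i).2[.
  rewrite lte_fin.
  by case: ltP => // h; rewrite lee_fin subr_le0.
Qed.

End nondecreasing_absolutely_continuous.

(** * The fundamental theorem of calculus for absolutely continuous functions *)

Section fundamental_theorem.
Context {R : realType}.

(** Composition with the retraction onto [a, b] turns a function on [a, b] into a
    cumulative function on the whole line, constant outside [a, b]. *)
Let clip (a b x : R) := Num.max a (Num.min x b).

Let clip_id (a b x : R) : a <= x -> x <= b -> clip a b x = x.
Proof. by move=> ax xb; rewrite /clip min_l// max_r. Qed.

Let clip_ge (a b x : R) : a <= clip a b x.
Proof. by rewrite /clip le_max lexx. Qed.

Let clip_le (a b x : R) : a <= b -> clip a b x <= b.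
Proof. by move=> ab; rewrite /clip ge_max ab ge_min lexx orbT. Qed.

Let clip_homo (a b : R) : {homo clip a b : x y / x <= y}.
Proof.
move=> x y xy; rewrite /clip.
by case: (leP x b) => ?; case: (leP y b) => ?; case: (leP a x) => ?;
  case: (leP a y) => ?; case: (leP a b) => ?; lra.
Qed.

Let clip_contract (a b x y : R) : x <= y -> clip a b y - clip a b x <= y - x.
Proof.
rewrite /clip => xy.
by case: (leP x b) => ?; case: (leP y b) => ?; case: (leP a x) => ?;
  case: (leP a y) => ?; case: (leP a b) => ?; lra.
Qed.

(** The density of the Stieltjes measure of G with respect to Lebesgue measure;
    restricting the former to ]a, b] makes it finite. *)
Lemma nondecreasing_absolutely_continuous_density (a b : R) (G : R -> R) :
  a <= b -> {in `[a, b] &, nondecreasing_fun G} ->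
  absolutely_continuous a b G ->
  exists2 psi : R -> R, lebesgue_measure.-integrable setT (EFin \o psi) &
    forall x, a <= x -> x <= b ->
      \int[lebesgue_measure]_(t in `]a, x]) psi t = G x - G a.
Proof.
move=> ab ndG GAC; pose Gc := G \o clip a b.
have clipab x : clip a b x \in `[a, b] by rewrite in_itv/= clip_ge clip_le.
have Gcnd : {homo Gc : x y / x <= y}.
  by move=> x y xy; apply: ndG => //; exact: clip_homo.
have Gcd := absolutely_continuous_dist GAC.
have Gcrc (x : R) : Gc y @[y --> x^'+] --> Gc x.
  apply/cvgrPdist_lt => e e0; have [d d0 fd] := Gcd e e0.
  near=> y; have xy : x <= y by near: y; exact: nbhs_right_ge.
  rewrite distrC; apply: fd; rewrite ?clip_ge ?clip_le ?clip_homo//.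
  rewrite (le_lt_trans (clip_contract _ _ xy))// ltrBlDl.
  by near: y; apply: nbhs_right_lt; rewrite ltrDl.
pose f : cumulative R R := HB.pack Gc (isCumulative.Build R _ R Gc Gcnd Gcrc).
have fdom : lebesgue_stieltjes_measure f `<< lebesgue_measure.
  apply: lebesgue_stieltjes_measure_dominates => e e0.
  have [d d0 fd] := absolutely_continuous_family GAC e0.
  exists d => // n u v uv tuv uvd.
  rewrite big_mkord.
  have := fd 'I_n (fun i => clip a b (u i)) (fun i => clip a b (v i)).
  move=> h; rewrite (eq_bigr (fun i : 'I_n =>
      `|G (clip a b (v i)) - G (clip a b (u i))|)); last first.
    by move=> i _; rewrite ger0_norm// subr_ge0 Gcnd.
  apply: h => [i| |].
  - by rewrite clip_ge clip_le ?clip_homo.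
  - move=> i j _ _ [x []] /=; rewrite !in_itv/= => xi xj.
    have sub k : clip a b (u k) < x < clip a b (v k) -> x \in `]u k, v k[.
      rewrite in_itv/= /clip gt_max gt_min lt_max lt_min.
      move=> /andP[/andP[ax ux] /orP[|/andP[xv xb]]]; first lra.
      by rewrite xv andbT; case/orP: ux => //; lra.
    by apply/val_inj/(tuv i j) => //; exists x; split; exact: sub.
  - rewrite (le_lt_trans _ uvd)// big_mkord ler_sum// => i _.
    exact: clip_contract.
have foo : (lebesgue_stieltjes_measure f `]a, b] < +oo)%E.
  by rewrite lebesgue_stieltjes_measure_itvoc// ltry.
have mab : measurable (`]a, b]%classic : set (measurableTypeR R)).
  exact: measurable_itv.
have := @radon_nikodym_sigma_finite _ _ _ lebesgue_measure (mfrestr mab foo).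
case.
  apply/null_content_dominatesP => A mA A0.
  rewrite /= /mfrestr /mrestr; apply/eqP; rewrite -measure_le0.
  move/null_content_dominatesP : fdom => /(_ A mA A0) <-.
  apply: le_measure; rewrite ?inE//; exact: measurableI.
move=> psi [psi0 psifin psiint psiE].
exists (fine \o psi).
  apply: eq_integrable psiint => // x _ /=; by rewrite fineK.
move=> x ax xb.
rewrite /Rintegral.
rewrite (eq_integral psi); last by move=> y _ /=; rewrite fineK.
have mx : measurable (`]a, x]%classic : set (measurableTypeR R)).
  exact: measurable_itv.
transitivity (fine (mfrestr mab foo `]a, x])); first by rewrite (psiE _ mx).
rewrite /mfrestr/= /mrestr setIidl; last first.
  by apply: subset_itvl; rewrite bnd_simp.
by rewrite lebesgue_stieltjes_measure_itvoc//= /Gc/= !clip_id.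
Unshelve. all: by end_near. Qed.

(** Jordan decomposition with the total variation V: both V and V - F are
    nondecreasing and absolutely continuous, hence integrals of densities, and
    the difference of the densities is almost everywhere the derivative of F. *)
Lemma absolutely_continuous_FTC (a b : R) (F : R -> R) : a <= b ->
  absolutely_continuous a b F ->
  exists psi : R -> R,
    [/\ lebesgue_measure.-integrable setT (EFin \o psi),
        forall x, a <= x -> x <= b ->
          \int[lebesgue_measure]_(t in `]a, x]) psi t = F x - F a &
        {ae lebesgue_measure, forall x, a < x -> x < b ->
          derivable F x 1 /\ derive1 F x = psi x}].
Proof.
move=> ab FAC; pose V x := fine (total_variation a x F).
have VAC := absolutely_continuous_total_variation ab FAC.
have VD := fine_total_variationB FAC.
have ndV : {in `[a, b] &, nondecreasing_fun V}.
  move=> x y; rewrite !in_itv/= => /andP[ax _] /andP[_ yb] xy.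
  by rewrite -subr_ge0 /V VD// fine_ge0// total_variation_ge0.
have ndVF : {in `[a, b] &, nondecreasing_fun (fun x => V x - F x)}.
  move=> x y; rewrite !in_itv/= => /andP[ax _] /andP[_ yb] xy.
  have : F y - F x <= V y - V x.
    rewrite /V VD// -lee_fin fineK ?(total_variation_fin_num FAC)//.
    rewrite (le_trans _ (total_variation_ge F xy))//.
    by rewrite lee_fin ler_norm.
  lra.
have [psi1 int1 psi1E] := nondecreasing_absolutely_continuous_density ab ndV VAC.
have [psi2 int2 psi2E] := nondecreasing_absolutely_continuous_density ab ndVF
  (absolutely_continuousB VAC FAC).
pose psi x := psi1 x - psi2 x.
have psiint : lebesgue_measure.-integrable setT (EFin \o psi).
  rewrite (_ : EFin \o psi = (EFin \o psi1) \- (EFin \o psi2))%E//.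
  exact: integrableB.
have psiE x : a <= x -> x <= b ->
    \int[lebesgue_measure]_(t in `]a, x]) psi t = F x - F a.
  move=> ax xb; have mx : measurable (`]a, x]%classic : set (measurableTypeR R)).
    exact: measurable_itv.
  rewrite RintegralB ?psi1E ?psi2E//; first by ring.
  - exact: integrableS int1.
  - exact: integrableS int2.
exists psi; split => //.
pose I x := \int[lebesgue_measure]_(t in `]a, x]) psi t.
have FTC := @FTC1 R psi (BRight a).
have {FTC} : {ae lebesgue_measure, forall x,
    (BRight a < BRight x)%O -> derivable I x 1 /\ derive1 I x = psi x}.
  apply: FTC => [y|]; first exact: integrableS psiint.
  by apply: open_integrable_locally => //; exact: openT.
apply: filterS; first exact: (ae_filter_ringOfSetsType lebesgue_measure).
move=> x /= + ax xb; rewrite bnd_simp => /(_ ax)[dI I'].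
have IF : is_derive x 1 (I \+ cst (F a)) (psi x).
  have dI1 : is_derive x 1 I (psi x) by apply: DeriveDef; rewrite -?derive1E.
  by have := is_deriveD dI1 (is_derive_cst (F a) x 1); rewrite addr0.
have FI : \forall y \near x, (I \+ cst (F a)) y = F y.
  near=> y; rewrite /I/= psiE ?subrK// ltW//.
    by near: y; exact: lt_nbhsr.
  by near: y; exact: lt_nbhsl.
have [dF F'] : is_derive x 1 F (psi x) by exact: near_eq_is_derive IF.
by split => //; rewrite derive1E.
Unshelve. all: by end_near. Qed.

End fundamental_theorem.

(** * Completed and Borel Lebesgue measure *)

Section completed_lebesgue.
Context {R : realType}.
Local Open Scope ereal_scope.

Local Notation mu := (@completed_lebesgue_measure R).
Local Notation cR := (caratheodory_type (wlength (@idfun R))^*%mu).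

Lemma completed_measurable (A : set R) :
  measurable A -> measurable (A : set cR).
Proof. exact: sub_caratheodory. Qed.

Lemma completed_itv_measurable (i : interval R) :
  measurable ([set` i] : set cR).
Proof. by apply: completed_measurable; exact: measurable_itv. Qed.

Lemma completed_itvcc (a b : R) : (a < b)%R -> mu `[a, b]%classic = (b - a)%:E.
Proof.
move=> ab; have -> : mu `[a, b]%classic = lebesgue_measure `[a, b]%classic by [].
by rewrite lebesgue_measure_itv/= lte_fin ab.
Qed.

Lemma completed_measurable_fun d (Y : measurableType d) (D : set R) (f : R -> Y) :
  measurable D -> measurable_fun D f -> measurable_fun (D : set cR) (f : cR -> Y).
Proof.
move=> mD mf _ B mB; apply: completed_measurable; exact: mf.
Qed.

Lemma completed_measurable_id (i : interval R) :
  measurable_fun ([set` i] : set cR) (fun t : cR => t : R).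
Proof.
apply: (completed_measurable_fun (f := fun t : R => t)).
  exact: measurable_itv.
exact: measurable_id.
Qed.

Lemma completed_measurable_powR (i : interval R) (r : R) :
  measurable_fun ([set` i] : set cR) (fun s : cR => (s : R) `^ r)%R.
Proof.
apply: (completed_measurable_fun (f := fun s : R => s `^ r)%R).
  exact: measurable_itv.
by apply: measurable_funTS; exact: measurable_powR.
Qed.

Lemma completed_ae (P : R -> Prop) :
  {ae lebesgue_measure, forall x, P x} -> {ae mu, forall x, P x}.
Proof.
move=> [A [mA A0 PA]]; exists A; split => //; exact: completed_measurable.
Qed.

(** The identity is measurable from the completed to the Borel structure, and it
    pushes the completed measure forward to Lebesgue measure. *)
Lemma ge0_integral_completed (D : set R) (f : R -> \bar R) : measurable D ->
  measurable_fun D f -> (forall x, D x -> 0 <= f x) ->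
  \int[mu]_(x in D) f x = \int[lebesgue_measure]_(x in D) f x.
Proof.
move=> mD mf f0.
have mid : measurable_fun setT (idfun : cR -> measurableTypeR R).
  move=> _ B mB; rewrite setTI; exact: completed_measurable.
have h := @ge0_integral_pushforward _ _ cR (measurableTypeR R) R idfun mid mu
  D f mD mf.
transitivity (\int[mu]_(x in idfun @^-1` D) (f \o idfun) x) => //.
rewrite -h; last by move=> x; rewrite inE; exact: f0.
by apply: eq_measure_integral => A mA AD.
Qed.

Local Open Scope ring_scope.

Lemma absolutely_continuous_measurable (a b : R) (f : R -> R) :
  absolutely_continuous a b f -> measurable_fun `[a, b] f.
Proof.
move=> fAC; apply: subspace_continuous_measurable_fun => //.
apply/subspace_continuousP => x; rewrite /= in_itv/= => /andP[ax xb].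
apply/cvgrPdist_lt => e e0; have [d d0 fd] := absolutely_continuous_dist fAC e0.
near=> y.
have : `[a, b]%classic y by near: y; exact: withinT.
rewrite /= in_itv/= => /andP[ay yb].
have : `|x - y| < d.
  near: y; apply: cvg_within; exact: (nbhsx_ballx x d d0).
have [xy|/ltW yx] := leP x y.
  rewrite distrC (distrC (f x)) ger0_norm ?subr_ge0//; exact: fd.
by rewrite ger0_norm ?subr_ge0//; exact: fd.
Unshelve. all: by end_near. Qed.

Lemma absolutely_continuous_completed_measurable (a b : R) (f : R -> R) :
  absolutely_continuous a b f ->
  measurable_fun (`[a, b]%classic : set cR) (f : cR -> R).
Proof.
move=> fAC.
apply: (completed_measurable_fun (f := f)) (absolutely_continuous_measurable fAC).
exact: measurable_itv.
Qed.

End completed_lebesgue.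

Section power_integral.
Context {R : realType}.
Local Notation mu := (@completed_lebesgue_measure R).

Lemma integral_powRN (x t r : R) : 0 < x -> x < t -> 1 < r ->
  (\int[mu]_(s in `]x, t]) (s `^ (- r))%:E)%E =
  ((x `^ (1 - r) - t `^ (1 - r)) / (r - 1))%:E.
Proof.
move=> x0 xt r1; have r10 : r - 1 != 0 by rewrite subr_eq0 gt_eqF.
pose F s := s `^ (1 - r) / (1 - r).
have dF s : x <= s -> is_derive s 1 F (s `^ (- r)).
  move=> xs; have s0 : 0 < s := lt_le_trans x0 xs.
  apply: is_derive_eq.
    exact: (is_deriveM (is_derive1_powR (1 - r) s0)
      (is_derive_cst ((1 - r)^-1) s (1 : R))).
  rewrite scaler0 add0r /GRing.scale/= mulKf; last by rewrite subr_eq0 lt_eqF.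
  by congr (_ `^ _); ring.
have cF s : x <= s -> {for s, continuous F}.
  move=> /dF[dFs _]; apply: differentiable_continuous; exact/derivable1_diffP.
have mp (D : set R) : measurable D ->
    measurable_fun D (fun s : R => (s `^ (- r))%:E).
  move=> mD; apply/measurable_EFinP; apply: measurable_funTS.
  exact: measurable_powR.
rewrite ge0_integral_completed//; [|exact: mp|]; last first.
  by move=> s _; rewrite lee_fin powR_ge0.
rewrite integral_itv_obnd_cbnd; last exact: mp.
rewrite (@continuous_FTC2 _ _ F)//.
- rewrite -EFinB; congr EFin; rewrite /F -[1 - r]opprB invrN !mulrN opprK addrC.
  by rewrite opprB mulrBl.
- apply: continuous_in_subspaceT => s; rewrite inE/= in_itv/= => /andP[xs _].
  have s0 : 0 < s := lt_le_trans x0 xs.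
  apply: differentiable_continuous; apply/derivable1_diffP.
  by have [] := is_derive1_powR (- r) s0.
- split.
  + by move=> s; rewrite in_itv/= => /andP[/ltW/dF[]].
  + by apply: cvg_at_right_filter; exact: cF.
  + by apply: cvg_at_left_filter; apply: cF; exact: ltW.
- move=> s; rewrite in_itv/= => /andP[/ltW/dF[_ +] _].
  by rewrite derive1E.
Qed.

End power_integral.

(** * Pompeiu's formula *)

Section pompeiu_mean_value.
Context {R : realType}.
Local Notation mu := (@completed_lebesgue_measure R).
Local Notation cR := (caratheodory_type (wlength (@idfun R))^*%mu).

(** The left-hand side is x t |F t - F x| for F s = f s / s. At the points where F
    is differentiable, f = l F is differentiable too and
    f - l f' = - l^2 F', which identifies the density of F. *)
Lemma pompeiu_increment_le (a b : R) (f : R -> R) : 0 < a -> a <= b ->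
  absolutely_continuous a b f ->
  measurable_fun (`[a, b]%classic : set cR)
    (fun t : cR => f t - t * derive1 f t) ->
  forall x t : R, a <= x -> x <= t -> t <= b ->
  (`|t * f x - x * f t|%:E <=
   (x * t)%:E *
   \int[mu]_(s in `]x, t]) (`|f s - s * derive1 f s| * s `^ (- 2))%:E)%E.
Proof.
move=> a0 ab fAC mh x t ax xt tb.
have x0 : 0 < x := lt_le_trans a0 ax.
have t0 : 0 < t := lt_le_trans x0 xt.
have [psi [psiint psiE psiae]] :=
  absolutely_continuous_FTC ab (absolutely_continuous_div_id a0 ab fAC).
have psiintS (D : set R) : measurable D ->
    lebesgue_measure.-integrable D (EFin \o psi).
  by move=> mD; exact: integrableS psiint.
have mpsi (D : set R) : measurable D -> measurable_fun D (EFin \o psi).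
  move=> mD; exact: measurable_int (psiintS _ mD).
have psixt : \int[lebesgue_measure]_(s in `]x, t]) psi s = f t / t - f x / x.
  rewrite -(@Rintegral_itvB _ _ (BRight a)) ?bnd_simp//; last exact: psiintS.
  by rewrite !psiE ?(le_trans ax)// ?(le_trans xt)//; ring.
have -> : `|t * f x - x * f t|%:E =
    ((x * t)%:E * `|\int[lebesgue_measure]_(s in `]x, t]) (psi s)%:E|)%E.
  have -> : t * f x - x * f t = - (x * t) * (f t / t - f x / x).
    by field; rewrite !gt_eqF.
  rewrite normrM normrN (gtr0_norm (mulr_gt0 x0 t0)) EFinM; congr (_ * _)%E.
  rewrite -psixt /Rintegral -abse_EFin fineK//.
  by apply: integrable_fin_num => //; exact: psiintS.
rewrite lee_wpmul2l ?lee_fin ?mulr_ge0 ?(ltW x0) ?(ltW t0)//.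
have mD : measurable (`]x, t]%classic : set R) by exact: measurable_itv.
apply: (le_trans (@le_abse_integral _ _ _ lebesgue_measure _ (EFin \o psi) mD
  (mpsi _ mD))).
have mabs : measurable_fun `]x, t] (abse \o (EFin \o psi)).
  by apply: measurableT_comp => //; exact: mpsi.
rewrite -ge0_integral_completed//.
rewrite le_eqVlt; apply/orP; left; apply/eqP.
have cD := completed_itv_measurable `]x, t].
have mhD : measurable_fun (`]x, t]%classic : set cR)
    (fun s : cR => `|f s - s * derive1 f s| * s `^ (- 2)).
  apply: measurable_funM.
    apply: (measurableT_comp (@normr_measurable R setT)).
    apply: (measurable_funS (completed_itv_measurable _) _ mh) => s /=.
    rewrite !in_itv/= => /andP[xs st].
    by rewrite (le_trans ax (ltW xs)) (le_trans st).
  exact: completed_measurable_powR.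
apply: ge0_ae_eq_integral cD _ _ _ _ _.
- exact: completed_measurable_fun.
- exact/measurable_EFinP.
- by move=> s _; exact: abse_ge0.
- by move=> s _; rewrite lee_fin mulr_ge0// powR_ge0.
(* the derivative is known only inside ]a, b[, and t may be equal to b *)
have neqb : {ae lebesgue_measure, forall s : R, s != b}.
  exists [set b]; split => //; first by rewrite lebesgue_measure_set1.
  by move=> s /= /negP; rewrite negbK => /eqP.
have : {ae lebesgue_measure, forall s, `]x, t]%classic s ->
    (abse \o (EFin \o psi)) s = (`|f s - s * derive1 f s| * s `^ (- 2))%:E}.
  apply: filterS2 psiae neqb.
    exact: (ae_filter_ringOfSetsType lebesgue_measure).
  move=> s /= + sb; rewrite in_itv/= => + /andP[xs st].
  have s0 : 0 < s := lt_trans x0 xs.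
  have sb' : s < b by rewrite lt_neqAle sb (le_trans st).
  move=> /(_ (le_lt_trans ax xs) sb')[dF F'].
  have sF : f s / s * s = f s by rewrite divfK// gt_eqF.
  have df : is_derive s 1 f (f s / s + s * psi s).
    have FI : \forall y \near s, ((fun y => f y / y) * idfun) y = f y.
      near=> y; rewrite fctE/= divfK// gt_eqF//; near: y; exact: lt_nbhsr.
    apply: near_eq_is_derive FI _; apply: is_derive_eq.
      apply: is_deriveM; first by apply: DeriveDef dF _; rewrite -derive1E F'.
    rewrite /GRing.scale/= mulr1//.
  rewrite derive1E; have [_ ->] := df.
  have -> : f s - s * (f s / s + s * psi s) = - (s ^+ 2 * psi s).
    by rewrite mulrDr mulrC sF opprD addrA subrr sub0r mulrA expr2.
  rewrite normrN normrM ger0_norm ?sqr_ge0// powR_invn ?(ltW s0)//.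
  by rewrite mulrAC divff ?mul1r// expf_neq0// gt_eqF.
exact: completed_ae.
Unshelve. all: by end_near. Qed.

End pompeiu_mean_value.

(** * Hoelder's inequality for a weighted integral *)

Section weighted_hoelder.
Context d (T : measurableType d) (R : realType).
Variable mu : {measure set T -> \bar R}.
Variables (D E : set T) (h w : T -> R).
Hypotheses (mD : measurable D) (mE : measurable E) (ED : E `<=` D).
Hypotheses (mh : measurable_fun D h) (mw : measurable_fun E w).
Hypothesis w0 : forall s, E s -> 0 <= w s.
Local Open Scope ereal_scope.

Let mhE : measurable_fun E h.
Proof. exact: measurable_funS mh. Qed.

Let mhD : measurable_fun [set: T] (h \_ D).
Proof. by apply/(measurable_restrictT _ _).1. Qed.

Let mhw : measurable_fun E (fun s => (`|h s| * w s)%:E).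
Proof.
by apply/measurable_EFinP/measurable_funM => //; exact: measurableT_comp.
Qed.

Lemma le_integral_weight_L1 (M : R) :
  (forall s, E s -> w s <= M)%R -> (0 <= M)%R ->
  \int[mu]_(s in E) (`|h s| * w s)%:E <= 'N[mu]_1[EFin \o (h \_ D)] * M%:E.
Proof.
move=> wM M0; rewrite Lnorm1 muleC -ge0_integralZl//; last first.
  by do 2 apply: measurableT_comp => //.
apply: (@le_trans _ _ (\int[mu]_(s in E) (M%:E * `|(EFin \o h \_ D) s|))).
  apply: ge0_le_integral => //.
  - by move=> s Es; rewrite lee_fin mulr_ge0 ?w0.
  - apply: measurable_funeM; apply: measurableT_comp => //.
    by apply/measurable_EFinP; exact: measurable_funTS.
  - move=> s Es /=; rewrite -EFinM lee_fin patchE mem_set; last exact: ED.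
    by rewrite mulrC ler_wpM2r// wM.
apply: ge0_subset_integral => //.
  by apply: measurable_funeM; do 2 apply: measurableT_comp => //.
by move=> s _; rewrite mule_ge0// lee_fin.
Qed.

Lemma le_integral_weight_Linfty : 0 < mu [set: T] ->
  'N[mu]_+oo[EFin \o (h \_ D)] \is a fin_num ->
  \int[mu]_(s in E) (`|h s| * w s)%:E <=
  'N[mu]_+oo[EFin \o (h \_ D)] * \int[mu]_(s in E) (w s)%:E.
Proof.
move=> muT Nfin; set N := 'N[mu]_+oo[_] in Nfin *.
rewrite -ge0_integralZl//; [|exact/measurable_EFinP|exact: Lnorm_ge0].
apply: ae_ge0_le_integral => //.
- by move=> s Es; rewrite lee_fin mulr_ge0 ?w0.
- by move=> s Es; rewrite mule_ge0 ?Lnorm_ge0 ?lee_fin ?w0.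
- by apply: measurable_funeM; exact/measurable_EFinP.
have : {ae mu, forall s, `|(EFin \o h \_ D) s| <= N}.
  by rewrite /N unlock muT; exact: ess_sup_ge.
apply: filterS => s /= + Es; rewrite patchE mem_set; last exact: ED.
by move=> hN; rewrite EFinM lee_wpmul2r// lee_fin w0.
Qed.

Lemma le_integral_weight_Lp (p q : R) : (0 < p)%R -> (0 < q)%R ->
  (p^-1 + q^-1 = 1)%R ->
  \int[mu]_(s in E) (`|h s| * w s)%:E <=
  'N[mu]_p%:E[EFin \o (h \_ D)] *
  (\int[mu]_(s in E) ((w s) `^ q)%:E) `^ (q^-1).
Proof.
move=> p0 q0 pq.
have mwE : measurable_fun [set: T] (w \_ E).
  by apply/(measurable_restrictT _ _).1.
have := hoelder mu mhD mwE p0 q0 pq.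
have -> : 'N[mu]_1[EFin \o (h \_ D \* w \_ E)%R] =
    \int[mu]_(s in E) (`|h s| * w s)%:E.
  rewrite Lnorm1 [RHS]integral_mkcond; apply: eq_integral => s _ /=.
  rewrite ![(_ \_ E) s]patchE; case: ifPn => [/set_mem Es|_].
    by rewrite patchE mem_set ?normrM ?(ger0_norm (w0 Es))//; exact: ED.
  by rewrite -[X in (_ * X)%R]/(0%R) mulr0 normr0.
suff -> : 'N[mu]_q%:E[EFin \o w \_ E] =
    (\int[mu]_(s in E) (w s `^ q)%:E) `^ q^-1 by [].
rewrite unlock; congr (_ `^ _).
rewrite [RHS]integral_mkcond; apply: eq_integral => s _ /=.
rewrite !patchE; case: ifPn => [/set_mem Es|_].
  by rewrite (ger0_norm (w0 Es)).
by rewrite normr0 powR0// gt_eqF.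
Qed.

End weighted_hoelder.

(** * Membership in L^p *)

Section Lfun_bounded.
Context d (T : measurableType d) (R : realType).
Variable mu : {measure set T -> \bar R}.
Variables (p : \bar R) (p1 : (1 <= p)%E).
Implicit Types (u v f m k : T -> R) (A D : set T).

Lemma Lfun_dominated u v : measurable_fun [set: T] u -> v \in Lfun mu p ->
  (forall x, `|u x| <= `|v x|) -> u \in Lfun mu p.
Proof.
move=> mu_ /andP[]; rewrite !inE/= => mv vfin uv.
apply/andP; split; rewrite inE//=.
apply: le_lt_trans vfin.
case: p p1 => [r r1|_|//]; rewrite unlock; last first.
  case: ifPn => // muT; apply: le_ess_sup; apply: nearW => x /=.
  by rewrite lee_fin.
have r0 : 0 < r by rewrite (lt_le_trans ltr01).
apply: gt0_ler_poweR; rewrite ?in_itv/= ?leey ?andbT.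
- by rewrite invr_ge0 ltW.
- by apply: integral_ge0 => x _; rewrite lee_fin powR_ge0.
- by apply: integral_ge0 => x _; rewrite lee_fin powR_ge0.
apply: ge0_le_integral => //=.
- apply/measurable_EFinP; apply: (measurableT_comp (measurable_powR _)).
  exact: measurableT_comp.
- apply/measurable_EFinP; apply: (measurableT_comp (measurable_powR _)).
  exact: measurableT_comp.
- by move=> x _; rewrite lee_fin ge0_ler_powR ?nnegrE ?(ltW r0).
Qed.

Lemma Lfun_indic A : measurable A -> (mu A < +oo)%E -> \1_A \in Lfun mu p.
Proof.
move=> mA Afin; apply/andP; split; rewrite inE/=; first exact: measurable_indic.
rewrite /finite_norm.
case: p p1 => [r r1|_|//]; rewrite unlock; last first.
  case: ifPn => // muT; apply: (@le_lt_trans _ _ 1%E); last exact: ltry.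
  apply/ess_supP; apply: nearW => x /=.
  by rewrite lee_fin indicE; case: (_ \in _); rewrite ?normr1 ?normr0.
have r0 : 0 < r by rewrite (lt_le_trans ltr01).
rewrite poweR_lty//.
rewrite (_ : (fun x => _) = EFin \o \1_A); first by rewrite integral_indic// setIT.
apply/funext => x /=; rewrite indicE; case: (_ \in _).
  by rewrite normr1 powR1.
by rewrite normr0 powR0// gt_eqF.
Qed.

(** With m the identity on a bounded interval and k = f', this puts f - l f' in
    L^p as soon as f' is. *)
Lemma Lfun_sub_mul D f m k (M B : R) : measurable D -> (mu D < +oo)%E ->
  measurable_fun D f -> measurable_fun D m ->
  (forall x, D x -> `|f x| <= M) -> (forall x, D x -> `|m x| <= B) ->
  k \_ D \in Lfun mu p -> (fun x => f x - m x * k x) \_ D \in Lfun mu p.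
Proof.
move=> mD Dfin mf mm fM mB kp.
have [L0 LD] := @Lfun_submod_closed _ _ _ mu _ p1.
have fL : f \_ D \in Lfun mu p.
  apply: (@Lfun_dominated _ (M *: (\1_D : T -> R))).
  - by apply/(measurable_restrictT _ _).1.
  - by rewrite -[X in X \in _]addr0; apply: LD => //; exact: Lfun_indic.
  - move=> x; rewrite -[X in _ <= `|X|]/(M * \1_D x) patchE indicE.
    case: ifPn => xD.
      by rewrite mulr1 (le_trans (fM _ (set_mem xD)))// ler_norm.
    by rewrite -[X in `|X| <= _]/(0%R) normr0.
have kL : (fun x => m x * k x) \_ D \in Lfun mu p.
  apply: (@Lfun_dominated _ (B *: (k \_ D : T -> R))).
  - apply/(measurable_restrictT _ _).1 => //; apply: measurable_funM => //.
    apply/(measurable_restrictT _ _).2 => //.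
    by move: kp => /andP[]; rewrite inE.
  - by rewrite -[X in X \in _]addr0; apply: LD.
  - move=> x /=; rewrite -[X in _ <= `|X|]/(B * (k \_ D) x) !patchE.
    case: ifPn => xD.
      by rewrite !normrM ler_wpM2r// (le_trans (mB _ (set_mem xD)))// ler_norm.
    by rewrite -[X in `|X| <= _]/(0%R) normr0.
suff -> : (fun x => f x - m x * k x) \_ D =
    -1 *: ((fun x => m x * k x) \_ D : T -> R) + f \_ D by exact: LD.
apply/funext => x; rewrite fctE -[X in X + _]/(-1 * _) mulN1r addrC !patchE.
case: ifPn => // _; exact/esym/subr0.
Qed.

End Lfun_bounded.

(** * Korkine's identity *)

Section nonmeasurable_comparison.
Context d (T : measurableType d) (R : realType).
Variable mu : {measure set T -> \bar R}.
Local Open Scope ereal_scope.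
Import HBNNSimple.

(** The integral of a nonnegative function is the supremum of the integrals of the
    simple functions below it, so comparison and scaling need no measurability.
    This is what allows iterated integrals to be compared without studying the
    measurability of the inner integral in its parameter. *)
Lemma ge0_le_integral_scale (D : set T) (u v : T -> \bar R) (c : R) :
  (0 <= c)%R -> (forall x, D x -> 0 <= u x) -> (forall x, D x -> 0 <= v x) ->
  (forall x, D x -> u x <= c%:E * v x) ->
  \int[mu]_(x in D) u x <= c%:E * \int[mu]_(x in D) v x.
Proof.
move=> c0 u0 v0 uv.
have [c_eq0|cn0] := eqVneq c 0%R.
  rewrite c_eq0 mul0e integral0_eq// => x Dx; apply/eqP.
  by rewrite eq_le u0// andbT (le_trans (uv _ Dx))// c_eq0 mul0e.
have {cn0}c_gt0 : (0 < c)%R by rewrite lt_neqAle eq_sym cn0.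
have ci0 : (0 <= c^-1)%R by rewrite invr_ge0.
rewrite !ge0_integralE//; apply: ge_ereal_sup => _ [h hu <-].
rewrite -[leLHS]mul1e -(divff (lt0r_neq0 c_gt0)) EFinM -muleA -sintegralrM.
apply: lee_wpmul2l; first by rewrite lee_fin.
apply: ereal_sup_ubound; exists (scale_nnsfun h ci0) => // x /=.
have := hu x; rewrite !patchE; case: ifPn => [/set_mem Dx|_] hx.
  by rewrite EFinM lee_pdivrMl// (le_trans hx)// uv.
by rewrite EFinM mule_ge0_le0.
Qed.

End nonmeasurable_comparison.

Section linear_combination.
Context d (T : measurableType d) (R : realType).
Variable mu : {measure set T -> \bar R}.

(** The inner and the outer integration of Korkine's identity both apply to a
    combination of the four functions l^2, l g, l f and f g. *)
Lemma Rintegral_comb4 (D : set T) (u1 u2 u3 u4 : T -> R) (c1 c2 c3 c4 : R) :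
  measurable D ->
  mu.-integrable D (EFin \o u1) -> mu.-integrable D (EFin \o u2) ->
  mu.-integrable D (EFin \o u3) -> mu.-integrable D (EFin \o u4) ->
  mu.-integrable D
    (EFin \o (fun x => c1 * u1 x + c2 * u2 x + c3 * u3 x + c4 * u4 x)) /\
  \int[mu]_(x in D) (c1 * u1 x + c2 * u2 x + c3 * u3 x + c4 * u4 x) =
  c1 * \int[mu]_(x in D) u1 x + c2 * \int[mu]_(x in D) u2 x +
  c3 * \int[mu]_(x in D) u3 x + c4 * \int[mu]_(x in D) u4 x.
Proof.
move=> mD i1 i2 i3 i4.
have iZ c u : mu.-integrable D (EFin \o u) ->
    mu.-integrable D (EFin \o (fun x => c * u x)).
  by move=> iu; have := integrableZl mD c iu.
have iD u v : mu.-integrable D (EFin \o u) -> mu.-integrable D (EFin \o v) ->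
    mu.-integrable D (EFin \o (fun x => u x + v x)).
  by move=> iu iv; have := integrableD mD iu iv.
have i12 := iD _ _ (iZ c1 _ i1) (iZ c2 _ i2).
have i123 := iD _ _ i12 (iZ c3 _ i3).
split; first exact: iD _ _ i123 (iZ c4 _ i4).
rewrite (RintegralD mD i123 (iZ c4 _ i4)) (RintegralD mD i12 (iZ c3 _ i3)).
by rewrite (RintegralD mD (iZ c1 _ i1) (iZ c2 _ i2)) !RintegralZl.
Qed.

End linear_combination.

Section korkine_identity.
Context d (T : measurableType d) (R : realType).
Variable mu : {measure set T -> \bar R}.
Variables (D : set T) (l f g : T -> R).
Hypothesis mD : measurable D.
Hypotheses (ill : mu.-integrable D (EFin \o (fun t => l t ^+ 2)))
  (ilf : mu.-integrable D (EFin \o (fun t => l t * f t)))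
  (ilg : mu.-integrable D (EFin \o (fun t => l t * g t)))
  (ifg : mu.-integrable D (EFin \o (fun t => f t * g t))).

Let K x t := (l t * f x - l x * f t) * (l t * g x - l x * g t).
Let J x := \int[mu]_(t in D) K x t.

Let K_expand x :
  K x = fun t => f x * g x * l t ^+ 2 + - (l x * f x) * (l t * g t)
    + - (l x * g x) * (l t * f t) + l x ^+ 2 * (f t * g t).
Proof. by apply/funext => t; rewrite /K; ring. Qed.

Lemma korkine_integrable x : mu.-integrable D (EFin \o K x).
Proof.
rewrite K_expand; exact: (Rintegral_comb4 _ _ _ _ mD ill ilg ilf ifg).1.
Qed.

Let J_expand : J = fun x =>
  (\int[mu]_(t in D) (f t * g t)) * l x ^+ 2
  + - (\int[mu]_(t in D) (l t * f t)) * (l x * g x)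
  + - (\int[mu]_(t in D) (l t * g t)) * (l x * f x)
  + (\int[mu]_(t in D) l t ^+ 2) * (f x * g x).
Proof.
apply/funext => x; rewrite /J K_expand.
by rewrite (Rintegral_comb4 _ _ _ _ mD ill ilg ilf ifg).2; ring.
Qed.

Lemma korkine_inner_integrable : mu.-integrable D (EFin \o J).
Proof.
rewrite J_expand; exact: (Rintegral_comb4 _ _ _ _ mD ill ilg ilf ifg).1.
Qed.

Lemma korkine : \int[mu]_(x in D) J x =
  2 * ((\int[mu]_(t in D) l t ^+ 2) * (\int[mu]_(t in D) (f t * g t)) -
       (\int[mu]_(t in D) (l t * f t)) * (\int[mu]_(t in D) (l t * g t))).
Proof.
rewrite J_expand (Rintegral_comb4 _ _ _ _ mD ill ilg ilf ifg).2.
by ring.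
Qed.

(** The kernel k is arbitrary, so the integrals on the right-hand side are
    compared by ge0_le_integral_scale, once for t and once for x. *)
Lemma korkine_le (C : R) (k : T -> T -> R) : 0 <= C ->
  (forall x t, D x -> D t -> 0 <= k x t) ->
  (forall x t, D x -> D t -> `|l t * f x - l x * f t| <= C * k x t) ->
  (`|(\int[mu]_(t in D) l t ^+ 2) * (\int[mu]_(t in D) (f t * g t)) -
     (\int[mu]_(t in D) (l t * f t)) * (\int[mu]_(t in D) (l t * g t))|%:E <=
  (1 / 2)%:E * (C%:E * \int[mu]_(x in D) \int[mu]_(t in D)
    (k x t * `|l t * g x - l x * g t|)%:E))%E.
Proof.
move=> C0 k0 fk; set P := _ - _.
have -> : `|P|%:E = ((1 / 2)%:E * `|\int[mu]_(x in D) (J x)%:E|)%E.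
  rewrite -(fineK (integrable_fin_num mD korkine_inner_integrable)).
  have := korkine; rewrite -/P {1}/Rintegral => ->.
  by rewrite /= -EFinM normrM ger0_norm// mulrA div1r mulVf// mul1r.
rewrite lee_wpmul2l ?lee_fin// ?divr_ge0//.
apply: le_trans
  (le_abse_integral _ mD (measurable_int _ korkine_inner_integrable)) _.
apply: ge0_le_integral_scale => // [x Dx|x Dx].
  by apply: integral_ge0 => t Dt; rewrite lee_fin mulr_ge0 ?k0.
have JE : (J x)%:E = (\int[mu]_(t in D) (K x t)%:E)%E.
  rewrite /J /Rintegral fineK//.
  exact: integrable_fin_num (korkine_integrable x).
rewrite -[(EFin \o J) x]/((J x)%:E) JE.
apply: le_trans
  (le_abse_integral _ mD (measurable_int _ (korkine_integrable x))) _.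
apply: ge0_le_integral_scale => // t Dt.
  by rewrite lee_fin mulr_ge0 ?k0.
by rewrite /= -EFinM lee_fin /K normrM mulrA ler_wpM2r// fk.
Qed.

End korkine_identity.

Section pompeiu_chebyshev_bound.
Context {R : realType}.
Local Notation mu := (@completed_lebesgue_measure R).
Local Notation cR := (caratheodory_type (wlength (@idfun R))^*%mu).

Lemma integral_sqr (a b : R) : a < b ->
  \int[mu]_(t in `[a, b]) t ^+ 2 = (b ^+ 3 - a ^+ 3) / 3.
Proof.
move=> ab; pose F t : R := t ^+ 3 / 3.
have dF (s : R) : is_derive s 1 F (s ^+ 2).
  by apply: is_derive_eq; rewrite /GRing.scale/=; field.
have cF (s : R) : {for s, continuous F}.
  have [dFs _] := dF s; apply: differentiable_continuous.
  exact/derivable1_diffP.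
rewrite /Rintegral ge0_integral_completed//; last 2 first.
- by apply/measurable_EFinP; exact: measurable_funTS.
- by move=> t _; rewrite lee_fin sqr_ge0.
rewrite (@continuous_FTC2 _ _ F)//=; first by rewrite /F; ring.
- by apply: continuous_subspaceT => s; exact: exprn_continuous.
- split.
  + by move=> s _; case: (dF s).
  + by apply: cvg_at_right_filter; exact: cF.
  + by apply: cvg_at_left_filter; exact: cF.
- by move=> s _; rewrite derive1E; case: (dF s).
Qed.

Lemma pompeiu_chebyshev_le (a b C : R) (f g : R -> R) (k : R -> R -> R) :
  a < b -> absolutely_continuous a b f -> Lebesgue_integrable a b g -> 0 <= C ->
  (forall x t, a <= x <= b -> a <= t <= b -> 0 <= k x t) ->
  (forall x t, a <= x <= b -> a <= t <= b ->
    `|t * f x - x * f t| <= C * k x t) ->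
  (`|pompeiu_chebyshev a b f g|%:E <= (1 / 2)%:E * (C%:E *
    double_integral a b (fun x t => k x t * `|t * g x - x * g t|)%R))%E.
Proof.
move=> ab fAC gint C0 k0 fk.
pose D : set cR := `[a, b]%classic.
have DE x : D x -> a <= x <= b by rewrite /D/= in_itv.
have mD : measurable D := completed_itv_measurable _.
have Dfin : (mu D < +oo)%E by rewrite completed_itvcc// ltry.
pose l : cR -> R := fun t => t.
have bnd (h : cR -> R) (N : R) : (forall x, D x -> `|h x| <= N) ->
    [bounded h x | x in D].
  move=> hN; exists N; split; first exact: num_real.
  by move=> M' NM' x /hN /le_trans; apply; exact: ltW.
have [M M0 fM] := absolutely_continuous_le_bound (ltW ab) fAC.
have ml : measurable_fun D l by exact: completed_measurable_id.
have mf := absolutely_continuous_completed_measurable fAC.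
have bl : [bounded l x | x in D].
  apply: (@bnd _ (`|a| + `|b|)) => x /DE/andP[ax xb] /=.
  have := ler_norm b; have := ler_norm (- a); rewrite normrN.
  have := normr_ge0 a; have := normr_ge0 b; rewrite /l ler_norml => *.
  by apply/andP; split; lra.
have bf : [bounded (f : cR -> R) x | x in D].
  by apply: (@bnd _ M) => x /DE/andP[ax xb]; exact: fM.
have il : mu.-integrable D (EFin \o l).
  exact: (measurable_bounded_integrable mD Dfin ml bl).
have ill : mu.-integrable D (EFin \o (fun t => l t ^+ 2)).
  by have := integrableMr mD ml bl il.
have ilf : mu.-integrable D (EFin \o (fun t => l t * f t)).
  by have := integrableMl mD il mf bf.
have ilg : mu.-integrable D (EFin \o (fun t => l t * g t)).
  by have := integrableMr mD ml bl gint.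
have ifg : mu.-integrable D (EFin \o (fun t => f t * g t)).
  by have := integrableMr mD mf bf gint.
rewrite /pompeiu_chebyshev -integral_sqr//.
apply: (korkine_le mD ill ilf ilg ifg C0) => x t /DE xab /DE tab.
- exact: k0.
- exact: fk.
Qed.

End pompeiu_chebyshev_bound.

(** * The three kernels *)

Section kernel_constants.
Context {R : realType}.

(** With q conjugate to p, the left-hand side is x t times the L^q norm of s^-2 on
    ]x, t]; the factor x t enters the root as (x t)^q. *)
Lemma powR_kernelE (x t q : R) : 0 < x -> x <= t -> 1 < q ->
  x * t * ((x `^ (1 - 2 * q) - t `^ (1 - 2 * q)) / (2 * q - 1)) `^ (1 / q) =
  (1 / (2 * q - 1)) `^ (1 / q) *
    `|x `^ q / t `^ (q - 1) - t `^ q / x `^ (q - 1)| `^ (1 / q).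
Proof.
move=> x0 xt q1; have t0 : 0 < t := lt_le_trans x0 xt.
have q0 : 0 < q by lra.
have q2 : 0 < 2 * q - 1 by lra.
have q21 : 0 <= 1 / (2 * q - 1) by rewrite divr_ge0// ltW.
have powE (s u : R) : 0 < s -> 0 < u ->
    (s * u) `^ q * s `^ (1 - 2 * q) = u `^ q / s `^ (q - 1).
  move=> s0 u0; rewrite powRM ?ltW// mulrC mulrA -powRD; last first.
    by rewrite (gt_eqF s0) implybT.
  by rewrite mulrC -powRN; congr (_ * _ `^ _); ring.
have le_pow : t `^ (1 - 2 * q) <= x `^ (1 - 2 * q).
  rewrite -[1 - 2 * q]opprB !powRN lef_pV2 ?posrE ?powR_gt0//.
  by rewrite ge0_ler_powR ?nnegrE ?(ltW x0, ltW t0, ltW q2).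
have -> : x * t = ((x * t) `^ q) `^ (1 / q).
  by rewrite -powRrM div1r divff ?gt_eqF// powRr1// mulr_ge0// ltW.
rewrite -!powRM ?powR_ge0//; last first.
  by rewrite mulr_ge0 ?subr_ge0// invr_ge0 ltW.
congr (_ `^ _).
rewrite distrC ger0_norm; last first.
  rewrite -powE// -[x `^ q / _]powE// mulrC [t * x]mulrC.
  by rewrite [X in X - _]mulrC -mulrBr mulr_ge0// ?powR_ge0// subr_ge0.
rewrite -(powE x t)// -(powE t x)// [t * x]mulrC; ring.
Qed.

End kernel_constants.

Section increment_bounds.
Context {R : realType}.
Local Notation mu := (@completed_lebesgue_measure R).
Local Notation cR := (caratheodory_type (wlength (@idfun R))^*%mu).
Variables (a b : R) (f : R -> R).
Hypotheses (a0 : 0 < a) (ab : a < b) (fAC : absolutely_continuous a b f).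

Let h t := f t - t * derive1 f t.

(** Finiteness matters because the norm is multiplied by a double integral that
    may vanish, and the product of +oo and 0 is 0. *)
Lemma Lp_norm_fin_num (p : \bar R) : (1 <= p)%E -> in_Lp a b p (derive1 f) ->
  measurable_fun (`[a, b]%classic : set cR) (h : cR -> R) /\
  Lp_norm a b p h \is a fin_num.
Proof.
move=> p1 f'Lp.
pose D : set cR := `[a, b]%classic.
have mD : measurable D := completed_itv_measurable _.
have Dfin : (mu D < +oo)%E by rewrite completed_itvcc// ltry.
have [M M0 fM] := absolutely_continuous_le_bound (ltW ab) fAC.
have mf := absolutely_continuous_completed_measurable fAC.
have ml : measurable_fun D (fun t : cR => t : R).
  exact: completed_measurable_id.
have : (h : cR -> R) \_ D \in Lfun mu p.
  apply: (@Lfun_sub_mul _ _ _ _ _ p1 _ _ _ _ M b) => //.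
  - by move=> x; rewrite /D/= in_itv/= => /andP[ax xb]; exact: fM.
  - move=> x; rewrite /D/= in_itv/= => /andP[ax xb].
    by rewrite ger0_norm// (le_trans (ltW a0)).
move=> /andP[]; rewrite !inE/= => mh hfin; split.
  by apply/(measurable_restrictT _ _).2.
by rewrite ge0_fin_numE// Lnorm_ge0.
Qed.

Let sub_itv x t : a <= x -> t <= b -> `]x, t]%classic `<=` `[a, b]%classic.
Proof.
move=> ax tb s /=; rewrite !in_itv/= => /andP[xs st].
by rewrite (le_trans ax (ltW xs)) (le_trans st).
Qed.

Let symmetric_bound (k : R -> R -> R) : (forall x t, k x t = k t x) ->
  (forall x t, a <= x -> x < t -> t <= b -> `|t * f x - x * f t| <= k x t) ->
  (forall x, 0 <= k x x) ->
  forall x t, a <= x <= b -> a <= t <= b -> `|t * f x - x * f t| <= k x t.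
Proof.
move=> ksym kle k0 x t /andP[ax xb] /andP[at_ tb].
have [xt|tx|->] := ltgtP x t; first exact: kle.
- by rewrite distrC ksym; exact: kle.
- by rewrite subrr normr0.
Qed.

Let itv_gt0 x t : a <= x -> x < t -> 0 < x * t.
Proof.
by move=> ax xt; rewrite mulr_gt0 ?(lt_le_trans a0)// (le_trans ax)// ltW.
Qed.

Let increment_le x t (V : \bar R) : a <= x -> x < t -> t <= b ->
  measurable_fun (`[a, b]%classic : set cR) (h : cR -> R) ->
  (\int[mu]_(s in `]x, t]) (`|h s| * s `^ (- 2))%:E <= V)%E ->
  (`|t * f x - x * f t|%:E <= (x * t)%:E * V)%E.
Proof.
move=> ax xt tb mh hV.
apply: le_trans (pompeiu_increment_le a0 (ltW ab) fAC mh ax (ltW xt) tb) _.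
by rewrite lee_wpmul2l// lee_fin ltW// itv_gt0.
Qed.

Let mu_gt0 : (0 < mu [set: cR])%E.
Proof.
apply: (@lt_le_trans _ _ (mu (`[a, b]%classic : set cR))).
  by rewrite completed_itvcc// lte_fin subr_gt0.
by apply: le_measure; rewrite ?inE//; exact: completed_itv_measurable.
Qed.

Lemma increment_le_Linfty : in_Lp a b +oo (derive1 f) ->
  forall x t, a <= x <= b -> a <= t <= b ->
  `|t * f x - x * f t| <= fine (Lp_norm a b +oo h) * `|x - t|.
Proof.
move=> /(Lp_norm_fin_num (leey _))[mh Nfin]; apply: symmetric_bound.
- by move=> x t; rewrite distrC.
- move=> x t ax xt tb; have x0 : 0 < x := lt_le_trans a0 ax.
  rewrite -lee_fin EFinM fineK//.
  have hoel := le_integral_weight_Linfty (completed_itv_measurable _)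
    (completed_itv_measurable _) (sub_itv ax tb) mh
    (@completed_measurable_powR R `]x, t] (- 2))
    (fun s _ => powR_ge0 s (- 2)) mu_gt0 Nfin.
  apply: (le_trans (increment_le ax xt tb mh hoel)).
  rewrite integral_powRN ?ltr1n// muleCA -EFinM.
  have -> : x * t * ((x `^ (1 - 2) - t `^ (1 - 2)) / (2 - 1)) = `|x - t|.
    rewrite ltr0_norm ?subr_lt0// opprB.
    have -> : 1 - 2 = - 1 :> R by ring.
    rewrite !powR_inv1 ?(ltW x0) ?(ltW (lt_trans x0 xt))//.
    by field; rewrite (gt_eqF x0) (gt_eqF (lt_trans x0 xt)).
  by [].
- by move=> x; rewrite mulr_ge0// fine_ge0// Lnorm_ge0.
Qed.

Lemma increment_le_L1 : in_Lp a b 1 (derive1 f) ->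
  forall x t, a <= x <= b -> a <= t <= b ->
  `|t * f x - x * f t| <=
    fine (Lp_norm a b 1 h) * (Num.max x t / Num.min x t).
Proof.
move=> /(Lp_norm_fin_num (lexx _))[mh Nfin]; apply: symmetric_bound.
- by move=> x t; rewrite maxC minC.
- move=> x t ax xt tb; have x0 : 0 < x := lt_le_trans a0 ax.
  rewrite -lee_fin EFinM fineK// max_r ?(ltW xt)// min_l ?(ltW xt)//.
  have wM s : `]x, t]%classic s -> s `^ (- 2) <= x `^ (- 2).
    rewrite /= in_itv/= => /andP[/ltW xs _].
    rewrite !powRN lef_pV2 ?posrE ?powR_gt0//; last exact: lt_le_trans xs.
    by rewrite ge0_ler_powR ?nnegrE ?(ltW x0)// (le_trans (ltW x0)).
  have hoel := le_integral_weight_L1 mu (completed_itv_measurable _)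
    (completed_itv_measurable _) (sub_itv ax tb) mh
    (@completed_measurable_powR R `]x, t] (- 2))
    (fun s _ => powR_ge0 s (- 2)) wM (powR_ge0 _ _).
  apply: (le_trans (increment_le ax xt tb mh hoel)).
  rewrite muleCA -EFinM powR_invn ?(ltW x0)//.
  have -> : x * t * x ^- 2 = t / x by field; rewrite gt_eqF.
  by [].
- move=> x; rewrite maxxx minxx mulr_ge0 ?fine_ge0 ?Lnorm_ge0//.
  by have [->|x0] := eqVneq x 0; rewrite ?mul0r// divff.
Qed.

Lemma increment_le_Lp (p q : R) : 1 < p -> 1 / p + 1 / q = 1 ->
  in_Lp a b p%:E (derive1 f) ->
  forall x t, a <= x <= b -> a <= t <= b ->
  `|t * f x - x * f t| <=
    (1 / (2 * q - 1)) `^ (1 / q) * fine (Lp_norm a b p%:E h) *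
    `|x `^ q / t `^ (q - 1) - t `^ q / x `^ (q - 1)| `^ (1 / q).
Proof.
move=> p1 pq /Lp_norm_fin_num[|mh Nfin]; first by rewrite lee_fin ltW.
have p0 : 0 < p by exact: lt_trans p1.
rewrite !div1r in pq *.
have qi0 : 0 < q^-1.
  by rewrite -(addKr p^-1 q^-1) pq addrC subr_gt0 invf_lt1.
have q0 : 0 < q by rewrite -invr_gt0.
have q1 : 1 < q.
  by rewrite -invf_lt1// -(addKr p^-1 q^-1) pq addrC ltrBlDr ltrDl invr_gt0.
apply: symmetric_bound.
- by move=> x t; rewrite distrC.
- move=> x t ax xt tb; have x0 : 0 < x := lt_le_trans a0 ax.
  rewrite -lee_fin mulrAC [X in (_ <= X)%E]EFinM fineK//.
  have hoel := le_integral_weight_Lp mu (completed_itv_measurable _)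
    (completed_itv_measurable _) (sub_itv ax tb) mh
    (@completed_measurable_powR R `]x, t] (- 2))
    (fun s _ => powR_ge0 s (- 2)) p0 q0 pq.
  apply: (le_trans (increment_le ax xt tb mh hoel)).
  under eq_integral do rewrite -powRrM mulNr.
  rewrite integral_powRN//; last by lra.
  rewrite muleCA poweR_EFin -EFinM muleC.
  have := powR_kernelE x0 (ltW xt) q1; rewrite !div1r => ->.
  by [].
- by move=> x; rewrite !mulr_ge0 ?powR_ge0// fine_ge0// Lnorm_ge0.
Qed.

End increment_bounds.

Unset Implicit Arguments.

Theorem theorem5 (R : realType) (a b : R) (f g : R -> R)
    (a_gt0 : 0 < a) (ab : a < b)
    (fAC : absolutely_continuous a b f)
    (gint : Lebesgue_integrable a b g) :
  [/\ in_Lp a b +oo%E (derive1 f) ->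
      (`|pompeiu_chebyshev a b f g|%:E <=
        (1 / 2)%:E * Lp_norm a b +oo (fun t => f t - t * derive1 f t)%R *
        double_integral a b
          (fun x t => `|x - t| * `|t * g x - x * g t|)%R)%E,
      (forall p q : R, 1 < p -> 1 / p + 1 / q = 1 ->
        in_Lp a b p%:E (derive1 f) ->
        (`|pompeiu_chebyshev a b f g|%:E <=
          (1 / 2)%:E * ((1 / (2 * q - 1)) `^ (1 / q))%:E *
          Lp_norm a b p%:E (fun t => f t - t * derive1 f t)%R *
          double_integral a b
            (fun x t => `|x `^ q / t `^ (q - 1) - t `^ q / x `^ (q - 1)|
                          `^ (1 / q) * `|t * g x - x * g t|)%R)%E) &
      in_Lp a b 1%E (derive1 f) ->
      (`|pompeiu_chebyshev a b f g|%:E <=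
        (1 / 2)%:E * Lp_norm a b 1 (fun t => f t - t * derive1 f t)%R *
        double_integral a b
          (fun x t => Num.max x t / Num.min x t * `|t * g x - x * g t|)%R)%E].
Proof.
have Lp0 p : 0 <= fine (Lp_norm a b p (fun t => f t - t * derive1 f t)).
  by rewrite fine_ge0// Lnorm_ge0.
split.
- move=> f'L; have [_ Nfin] := Lp_norm_fin_num a_gt0 ab fAC (leey _) f'L.
  rewrite -[X in (_ * X * _)%E](fineK Nfin) -muleA.
  apply: pompeiu_chebyshev_le => //.
  exact: increment_le_Linfty.
- move=> p q p1 pq f'L.
  have p1' : (1 <= p%:E)%E by rewrite lee_fin ltW.
  have [_ Nfin] := Lp_norm_fin_num a_gt0 ab fAC p1' f'L.
  rewrite -[X in (_ * X * _)%E](fineK Nfin) -!muleA [X in (_ * X)%E]muleA -EFinM.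
  apply: pompeiu_chebyshev_le => //.
  + by rewrite mulr_ge0 ?powR_ge0.
  + exact: increment_le_Lp.
- move=> f'L; have [_ Nfin] := Lp_norm_fin_num a_gt0 ab fAC (lexx _) f'L.
  rewrite -[X in (_ * X * _)%E](fineK Nfin) -muleA.
  apply: pompeiu_chebyshev_le => //; last exact: increment_le_L1.
  move=> x t /andP[ax _] /andP[at_ _].
  rewrite divr_ge0// ?le_max ?le_min (ltW (lt_le_trans a_gt0 ax))//.
  by rewrite (ltW (lt_le_trans a_gt0 at_)).
Qed.
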